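(* Let $\Gamma\subset\mathbb{R}^2$ be a lattice, $\Lambda>0$ smooth and $\Gamma$-periodic, and let $F=\sum_{i=0}^4a_ip_1^{4-i}p_2^i$ with smooth $\Gamma$-periodic $a_i$ satisfy $\{H,F\}=0$, $H=\frac{p_1^2+p_2^2}{2\Lambda}$, with $a_3=a_1$ and $a_4=c_2+a_2-a_0$ for a constant $c_2$ (Kolokoltsov relations with $c_1=0$). Define the constants $$a_{11}=\tfrac12\big\langle(2c_2-2a_0+a_2)\Lambda\big\rangle,\quad a_{22}=\tfrac12\langle(2a_0-a_2)\Lambda\rangle,\quad a_{12}=\tfrac12\langle a_1\Lambda\rangle .$$ Let $\lambda$ be a smooth $\Gamma$-periodic solution of $\Delta\lambda=2c_2\Lambda-2a_{11}-2a_{22}$. Then $$\lambda_{xy}(\lambda_{yyyy}-\lambda_{xxxx})+3(\lambda_{yyy}\lambda_{xyy}-\lambda_{xxy}\lambda_{xxx})+2(\lambda_{yy}\lambda_{xyyy}-\lambda_{xx}\lambda_{xxxy})+4a_{22}\lambda_{xyyy}-4a_{11}\lambda_{xxxy}+2a_{12}(\lambda_{yyyy}-\lambda_{xxxx})=0 .$$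
   Context: $\{H,F\}=\sum_{j=1}^2\left(\frac{\partial H}{\partial q^j}\frac{\partial F}{\partial p_j}-\frac{\partial H}{\partial p_j}\frac{\partial F}{\partial q^j}\right)$, $(q^1,q^2)=(x,y)$; so $F$ is a quartic first integral of the geodesic flow of $\Lambda(dx^2+dy^2)$ on $\mathbb{R}^2/\Gamma$. $\langle g\rangle$ denotes the average of a $\Gamma$-periodic function $g$ over a fundamental domain of $\Gamma$. $\Delta=\partial_x^2+\partial_y^2$. *)

(* Defs.v *)
From Stdlib Require Import Reals.
Open Scope R_scope.

Definition cont2 (f : R -> R -> R) (x y : R) : Prop :=
  forall eps, 0 < eps -> exists delta, 0 < delta /\
    forall u v, Rabs (u - x) < delta -> Rabs (v - y) < delta ->
      Rabs (f u v - f x y) < eps.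

(* D i j = d^i/dx^i d^j/dy^j f : the family of all partial derivatives of f,
   each jointly continuous (so f is C^infty). *)
Definition deriv_family (f : R -> R -> R) (D : nat -> nat -> R -> R -> R) : Prop :=
  (forall x y, D 0%nat 0%nat x y = f x y) /\
  (forall i j x y, derivable_pt_lim (fun s => D i j s y) x (D (S i) j x y)) /\
  (forall i j x y, derivable_pt_lim (fun t => D i j x t) y (D i (S j) x y)) /\
  (forall i j x y, cont2 (D i j) x y).

Definition smooth2 (f : R -> R -> R) : Prop := exists D, deriv_family f D.

(* The lattice Gamma = Z e1 + Z e2 with e1=(e1x,e1y), e2=(e2x,e2y) independent. *)
Definition lattice_basis (e1x e1y e2x e2y : R) : Prop := e1x * e2y - e1y * e2x <> 0.

Definition periodic (e1x e1y e2x e2y : R) (f : R -> R -> R) : Prop :=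
  forall x y, f (x + e1x) (y + e1y) = f x y /\ f (x + e2x) (y + e2y) = f x y.

Definition integral01 (h : R -> R) (v : R) : Prop :=
  exists pr : Riemann_integrable h 0 1, RiemannInt pr = v.

(* <g> = v : average over the fundamental parallelogram {s e1 + t e2 : s,t in [0,1]},
   computed in lattice coordinates (the Jacobian cancels in the average). *)
Definition is_avg (e1x e1y e2x e2y : R) (g : R -> R -> R) (v : R) : Prop :=
  exists inner : R -> R,
    (forall t, integral01 (fun s => g (s * e1x + t * e2x) (s * e1y + t * e2y)) (inner t)) /\
    integral01 inner v.

(* {H,F} = 0 for phase-space functions of (x,y,p1,p2), with the bracket
   sum_j (dH/dq^j dF/dp_j - dH/dp_j dF/dq^j), stated for all values of the
   partial derivatives (which are unique when they exist). *)
Definition poisson_commute (H F : R -> R -> R -> R -> R) : Prop :=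
  forall x y p1 p2 Hx Hy Hp1 Hp2 Fx Fy Fp1 Fp2,
    derivable_pt_lim (fun s => H s y p1 p2) x Hx ->
    derivable_pt_lim (fun s => H x s p1 p2) y Hy ->
    derivable_pt_lim (fun s => H x y s p2) p1 Hp1 ->
    derivable_pt_lim (fun s => H x y p1 s) p2 Hp2 ->
    derivable_pt_lim (fun s => F s y p1 p2) x Fx ->
    derivable_pt_lim (fun s => F x s p1 p2) y Fy ->
    derivable_pt_lim (fun s => F x y s p2) p1 Fp1 ->
    derivable_pt_lim (fun s => F x y p1 s) p2 Fp2 ->
    (Hx * Fp1 - Hp1 * Fx) + (Hy * Fp2 - Hp2 * Fy) = 0.

(* Main.v *)
(* Expanding {H, F} = 0 in the momenta gives Kolokoltsov's first-order
   system for Lam, a0, a1, a2.  Two of its equations, together with the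
   y-derivative of Delta lam = 2 c2 Lam - 2 a11 - 2 a22, say that
     g = Lam (2 a0 - a2) - 2 a22 - lam_yy   and   w = Lam a1 - 2 a12 - lam_xy
   satisfy the Cauchy-Riemann equations.  Being periodic, g is harmonic and
   hence constant (energy argument: the mean of |grad g|^2 vanishes), and the
   choice of a22, a12 makes the means of g and w zero; so lam_yy and lam_xy
   are expressed through the metric.  The remaining two equations then give
   both partials of Lam^2 a0; their compatibility (equality of the mixed
   partials), with Lam eliminated through the Laplace equation when c2 <> 0,
   is the claimed identity.  When c2 = 0, lam is periodic harmonic and all its
   derivatives vanish. *)

Require Import Defs.
From Stdlib Require Import Reals Lra Lia Psatz ZArith.
From Coquelicot Require Import Coquelicot.
Open Scope R_scope.

Lemma cont2_iff f x y : cont2 f x y <-> continuity_2d_pt f x y.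
Proof.
  split.
  - intros H eps. destruct (H eps (cond_pos eps)) as [d [Hd Hclose]].
    exists (mkposreal d Hd). exact Hclose.
  - intros H eps He. destruct (H (mkposreal eps He)) as [d Hclose].
    exists d. split; [apply cond_pos | exact Hclose].
Qed.

Lemma cont2_const c x y : cont2 (fun _ _ => c) x y.
Proof. apply cont2_iff, continuity_2d_pt_const. Qed.

Lemma cont2_plus f g x y :
  cont2 f x y -> cont2 g x y -> cont2 (fun u v => f u v + g u v) x y.
Proof. rewrite !cont2_iff. apply continuity_2d_pt_plus. Qed.

Lemma cont2_minus f g x y :
  cont2 f x y -> cont2 g x y -> cont2 (fun u v => f u v - g u v) x y.
Proof. rewrite !cont2_iff. apply continuity_2d_pt_minus. Qed.

Lemma cont2_mult f g x y :
  cont2 f x y -> cont2 g x y -> cont2 (fun u v => f u v * g u v) x y.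
Proof. rewrite !cont2_iff. apply continuity_2d_pt_mult. Qed.

Lemma cont2_ext f g x y : (forall u v, f u v = g u v) -> cont2 f x y -> cont2 g x y.
Proof.
  intros E H eps He. destruct (H eps He) as [d [Hd Hclose]].
  exists d; split; [exact Hd |]. intros u v Hu Hv. rewrite <- !E. auto.
Qed.

Lemma cont2_linear_comp g a b c d s t :
  cont2 g (s * a + t * b) (s * c + t * d) ->
  cont2 (fun s t => g (s * a + t * b) (s * c + t * d)) s t.
Proof.
  intros H eps He. destruct (H eps He) as [del [Hdel Hclose]].
  set (K := Rabs a + Rabs b + Rabs c + Rabs d + 1).
  assert (HK : 0 < K)
    by (unfold K; generalize (Rabs_pos a) (Rabs_pos b) (Rabs_pos c) (Rabs_pos d); lra).
  set (r := del / (2 * K)).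
  assert (Hr : 0 < r) by (apply Rdiv_lt_0_compat; lra).
  assert (HrK : r * K = del / 2) by (unfold r; field; lra).
  assert (Small : forall u v p q, Rabs (u - s) < r -> Rabs (v - t) < r ->
            Rabs p + Rabs q <= K -> Rabs ((u - s) * p + (v - t) * q) < del).
  { intros u v p q Hu Hv Hpq.
    eapply Rle_lt_trans; [apply Rabs_triang |]. rewrite !Rabs_mult.
    assert (Rabs (u - s) * Rabs p <= r * Rabs p)
      by (apply Rmult_le_compat_r; [apply Rabs_pos | lra]).
    assert (Rabs (v - t) * Rabs q <= r * Rabs q)
      by (apply Rmult_le_compat_r; [apply Rabs_pos | lra]).
    assert (r * (Rabs p + Rabs q) <= r * K) by (apply Rmult_le_compat_l; lra).
    lra. }
  exists r. split; [exact Hr |]. intros u v Hu Hv. apply Hclose.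
  - replace (u * a + v * b - (s * a + t * b)) with ((u - s) * a + (v - t) * b) by ring.
    apply Small; auto. unfold K; generalize (Rabs_pos c) (Rabs_pos d); lra.
  - replace (u * c + v * d - (s * c + t * d)) with ((u - s) * c + (v - t) * d) by ring.
    apply Small; auto. unfold K; generalize (Rabs_pos a) (Rabs_pos b); lra.
Qed.

Lemma continuous_of_eps_delta (f : R -> R) x :
  (forall eps, 0 < eps -> exists d, 0 < d /\
     forall z, Rabs (z - x) < d -> Rabs (f z - f x) < eps) ->
  continuous f x.
Proof.
  intros H. apply continuity_pt_filterlim. intros eps He.
  destruct (H eps He) as [d [Hd Hclose]]. exists d. split; [lra |].
  intros z [_ Hz]. exact (Hclose z Hz).
Qed.

Lemma eps_delta_of_continuous (f : R -> R) x : continuous f x ->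
  forall eps, 0 < eps -> exists d, 0 < d /\
    forall z, Rabs (z - x) < d -> Rabs (f z - f x) < eps.
Proof.
  intros H eps He. apply continuity_pt_filterlim in H.
  destruct (H eps He) as [d [Hd Hclose]]. exists d; split; [exact Hd |]. intros z Hz.
  destruct (Req_dec z x) as [E | E].
  - subst. rewrite Rminus_eq_0, Rabs_R0; auto.
  - apply (Hclose z). split; [split; [exact I | auto] | exact Hz].
Qed.

Lemma cont2_continuous_x G s t : cont2 G s t -> continuous (fun s => G s t) s.
Proof.
  intros H. apply continuous_of_eps_delta. intros eps He.
  destruct (H eps He) as [d [Hd Hclose]]. exists d; split; [exact Hd |].
  intros z Hz. apply Hclose; [exact Hz |]. rewrite Rminus_eq_0, Rabs_R0; exact Hd.
Qed.

(* Continuity of one partial derivative and existence of the other give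
   (Fréchet) differentiability, via the mean value theorem in x. *)
Lemma differentiable_of_partials k kx ky x y :
  (forall u v, derivable_pt_lim (fun s => k s v) u (kx u v)) ->
  (forall u v, derivable_pt_lim (fun t => k u t) v (ky u v)) ->
  cont2 kx x y -> differentiable_pt_lim k x y (kx x y) (ky x y).
Proof.
  intros Hx Hy Hc eps.
  assert (He2 : 0 < eps / 2) by (generalize (cond_pos eps); lra).
  destruct (Hc _ He2) as [d1 [Hd1 Hclose]].
  destruct (Hy x y _ He2) as [d2 Hd2].
  exists (mkposreal (Rmin d1 d2) (Rmin_pos _ _ Hd1 (cond_pos d2))).
  intros u v Hu Hv. simpl in Hu, Hv.
  assert (Hu1 : Rabs (u - x) < d1) by (eapply Rlt_le_trans; [apply Hu | apply Rmin_l]).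
  assert (Hv1 : Rabs (v - y) < d1) by (eapply Rlt_le_trans; [apply Hv | apply Rmin_l]).
  assert (Hv2 : Rabs (v - y) < d2) by (eapply Rlt_le_trans; [apply Hv | apply Rmin_r]).
  destruct (MVT_gen (fun s => k s v) x u (fun s => kx s v)) as [c [Hc1 Hc2]].
  { intros z _. apply is_derive_Reals. apply Hx. }
  { intros z _. apply derivable_continuous_pt. exists (kx z v). apply Hx. }
  assert (Hcd : Rabs (c - x) < d1).
  { apply Rle_lt_trans with (Rabs (u - x)); auto.
    unfold Rmin, Rmax in Hc1; destruct (Rle_dec x u); unfold Rabs;
      repeat destruct Rcase_abs; lra. }
  specialize (Hclose c v Hcd Hv1).
  assert (Hvy : Rabs (k x v - k x y - ky x y * (v - y)) <= eps / 2 * Rabs (v - y)).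
  { destruct (Req_dec v y) as [E | E].
    - subst. replace (k x y - k x y - ky x y * (y - y)) with 0 by ring.
      rewrite Rabs_R0. apply Rmult_le_pos; [lra | apply Rabs_pos].
    - specialize (Hd2 (v - y)). replace (y + (v - y)) with v in Hd2 by ring.
      specialize (Hd2 ltac:(lra) Hv2).
      replace (k x v - k x y - ky x y * (v - y))
        with (((k x v - k x y) / (v - y) - ky x y) * (v - y)) by (field; lra).
      rewrite Rabs_mult. apply Rmult_le_compat_r; [apply Rabs_pos | lra]. }
  replace (k u v - k x y - (kx x y * (u - x) + ky x y * (v - y)))
    with ((kx c v - kx x y) * (u - x) + (k x v - k x y - ky x y * (v - y)))
    by (replace (k u v) with (k x v + kx c v * (u - x)) by lra; ring).
  eapply Rle_trans; [apply Rabs_triang |]. rewrite Rabs_mult.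
  assert (Rabs (u - x) <= Rmax (Rabs (u - x)) (Rabs (v - y))) by apply Rmax_l.
  assert (Rabs (v - y) <= Rmax (Rabs (u - x)) (Rabs (v - y))) by apply Rmax_r.
  assert (Rabs (kx c v - kx x y) * Rabs (u - x) <= eps / 2 * Rabs (u - x))
    by (apply Rmult_le_compat_r; [apply Rabs_pos | lra]).
  generalize (cond_pos eps) (Rabs_pos (u - x)) (Rabs_pos (v - y)). nra.
Qed.

Lemma derivable_along_line k kx ky p q r w s0 :
  (forall u v, derivable_pt_lim (fun s => k s v) u (kx u v)) ->
  (forall u v, derivable_pt_lim (fun t => k u t) v (ky u v)) ->
  (forall u v, cont2 kx u v) ->
  derivable_pt_lim (fun s => k (s * p + q) (s * r + w)) s0
    (kx (s0 * p + q) (s0 * r + w) * p + ky (s0 * p + q) (s0 * r + w) * r).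
Proof.
  intros Hx Hy Hc.
  apply (derivable_pt_lim_comp_2d k (fun s => s * p + q) (fun s => s * r + w)).
  - apply differentiable_of_partials; auto.
  - apply is_derive_Reals. auto_derive; auto; ring.
  - apply is_derive_Reals. auto_derive; auto; ring.
Qed.

Lemma same_partial_x (f h : R -> R -> R) u v l1 l2 : (forall a b, f a b = h a b) ->
  derivable_pt_lim (fun s => f s v) u l1 -> derivable_pt_lim (fun s => h s v) u l2 ->
  l1 = l2.
Proof.
  intros E H1 H2. apply (uniqueness_limite (fun s => f s v) u); auto.
  apply (derivable_pt_lim_ext (fun s => h s v)); [intros; rewrite E; auto | auto].
Qed.

Lemma same_partial_y (f h : R -> R -> R) u v l1 l2 : (forall a b, f a b = h a b) ->
  derivable_pt_lim (fun t => f u t) v l1 -> derivable_pt_lim (fun t => h u t) v l2 ->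
  l1 = l2.
Proof.
  intros E H1 H2. apply (uniqueness_limite (fun t => f u t) v); auto.
  apply (derivable_pt_lim_ext (fun t => h u t)); [intros; rewrite E; auto | auto].
Qed.

Lemma constant_of_zero_derivative (h : R -> R) :
  (forall x, derivable_pt_lim h x 0) -> forall a b, h a = h b.
Proof.
  intros H a b.
  destruct (MVT_gen h a b (fun _ => 0)) as [c [_ Hc]].
  - intros x _. apply is_derive_Reals, H.
  - intros x _. apply derivable_continuous_pt. exists 0. apply H.
  - lra.
Qed.

Lemma constant_of_zero_gradient g gx gy :
  (forall u v, derivable_pt_lim (fun s => g s v) u (gx u v)) ->
  (forall u v, derivable_pt_lim (fun t => g u t) v (gy u v)) ->
  (forall u v, gx u v = 0 /\ gy u v = 0) -> forall u v, g u v = g 0 0.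
Proof.
  intros Hx Hy Z u v.
  rewrite (constant_of_zero_derivative (fun s => g s v)) with (b := 0).
  - apply (constant_of_zero_derivative (fun t => g 0 t)).
    intros t. pose proof (Hy 0 t) as Ht. rewrite (proj2 (Z 0 t)) in Ht. exact Ht.
  - intros s. pose proof (Hx s v) as Hs. rewrite (proj1 (Z s v)) in Hs. exact Hs.
Qed.

Lemma is_RInt_of_integral01 h v : integral01 h v -> is_RInt h 0 1 v.
Proof.
  intros [pr E]. rewrite <- E, <- RInt_Reals.
  apply (RInt_correct (V := R_CompleteNormedModule)). apply ex_RInt_Reals_1; auto.
Qed.

Lemma is_RInt_const01 (k : R) : is_RInt (V := R_NormedModule) (fun _ => k) 0 1 k.
Proof.
  pose proof (is_RInt_const (V := R_NormedModule) 0 1 k) as H.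
  unfold scal in H; simpl in H; unfold mult in H; simpl in H.
  replace ((1 - 0) * k) with k in H by ring. exact H.
Qed.

Lemma is_RInt_eq_value (f : R -> R) a b (l l' : R) :
  is_RInt (V := R_NormedModule) f a b l -> l = l' -> is_RInt (V := R_NormedModule) f a b l'.
Proof. intros H E; subst; exact H. Qed.

Lemma ex_RInt_slice G t : (forall s t, cont2 G s t) -> ex_RInt (fun s => G s t) 0 1.
Proof.
  intros H. apply (ex_RInt_continuous (V := R_CompleteNormedModule)).
  intros z _. apply cont2_continuous_x, H.
Qed.

(* An integral depending on a parameter is continuous in the parameter when
   the integrand is jointly continuous (uniform continuity on [0,1]). *)
Lemma parametric_integral_continuous G t0 : (forall s t, cont2 G s t) ->
  continuous (fun t => RInt (fun s => G s t) 0 1) t0.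
Proof.
  intros H. apply continuous_of_eps_delta. intros eps He.
  destruct (uniform_continuity_2d_1d' (fun t s => G s t) 0 1 t0)
    with (eps := mkposreal (eps / 2) ltac:(lra)) as [d Hd].
  { intros x _. apply cont2_iff. intros e He'.
    destruct (H x t0 e He') as [d [Hd' Hclose]]. exists d; split; auto. }
  exists d. split; [apply cond_pos |]. intros z Hz.
  rewrite <- (RInt_minus (V := R_CompleteNormedModule) (fun s => G s z) (fun s => G s t0))
    by apply ex_RInt_slice, H.
  eapply Rle_lt_trans; [apply abs_RInt_le_const with (M := eps / 2) | lra]; [lra | | ].
  - apply (ex_RInt_minus (V := R_NormedModule)); apply ex_RInt_slice, H.
  - intros s Hs. left. apply (Hd s t0 s z Hs); auto.
    + split; generalize (cond_pos d); lra.
    + unfold Rabs in Hz; destruct Rcase_abs in Hz; lra.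
    + rewrite Rminus_eq_0, Rabs_R0. apply cond_pos.
Qed.

(* A continuous nonnegative function with zero integral on [0,1] vanishes
   there: otherwise it exceeds half its value on a subinterval. *)
Lemma nonneg_zero_integral (f : R -> R) :
  (forall x, 0 <= x <= 1 -> continuous f x) -> (forall x, 0 <= x <= 1 -> 0 <= f x) ->
  is_RInt f 0 1 0 -> forall x, 0 <= x <= 1 -> f x = 0.
Proof.
  intros Hc Hp Hi x0 Hx0.
  destruct (Req_dec (f x0) 0) as [E | E]; [exact E | exfalso].
  assert (Hpos : 0 < f x0) by (generalize (Hp x0 Hx0); lra).
  destruct (eps_delta_of_continuous f x0 (Hc x0 Hx0) (f x0 / 2) ltac:(lra))
    as [d [Hd Hclose]].
  set (a := Rmax 0 (x0 - d / 2)). set (b := Rmin 1 (x0 + d / 2)).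
  assert (Ha : 0 <= a <= x0) by (unfold a, Rmax; destruct Rle_dec; lra).
  assert (Hb : x0 <= b <= 1) by (unfold b, Rmin; destruct Rle_dec; lra).
  assert (Hab : a < b) by (unfold a, b, Rmax, Rmin; repeat destruct Rle_dec; lra).
  assert (Hex : forall u v, 0 <= u -> u <= v -> v <= 1 -> ex_RInt f u v).
  { intros u v H1 H2 H3. apply (ex_RInt_continuous (V := R_CompleteNormedModule)).
    intros z Hz. apply Hc. unfold Rmin, Rmax in Hz; destruct Rle_dec; lra. }
  assert (I1 : 0 <= RInt f 0 a)
    by (apply RInt_ge_0; try lra; [apply Hex; lra | intros; apply Hp; lra]).
  assert (I3 : 0 <= RInt f b 1)
    by (apply RInt_ge_0; try lra; [apply Hex; lra | intros; apply Hp; lra]).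
  assert (I2 : f x0 / 2 * (b - a) <= RInt f a b).
  { replace (f x0 / 2 * (b - a)) with (RInt (fun _ => f x0 / 2) a b)
      by (rewrite RInt_const; unfold scal; simpl; unfold mult; simpl; ring).
    apply RInt_le; [lra | apply ex_RInt_const | apply Hex; lra |].
    intros z Hz. assert (Hzd : Rabs (z - x0) < d).
    { unfold a, b, Rmax, Rmin in Hz. repeat destruct Rle_dec in Hz;
        unfold Rabs; destruct Rcase_abs; lra. }
    specialize (Hclose z Hzd). unfold Rabs in Hclose; destruct Rcase_abs in Hclose; lra. }
  assert (Etot : RInt f 0 1 = RInt f 0 a + RInt f a b + RInt f b 1).
  { rewrite <- (RInt_Chasles (V := R_CompleteNormedModule) f 0 a 1) by (apply Hex; lra).
    rewrite <- (RInt_Chasles (V := R_CompleteNormedModule) f a b 1) by (apply Hex; lra).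
    unfold plus; simpl. ring. }
  rewrite (is_RInt_unique (V := R_CompleteNormedModule) _ _ _ _ Hi) in Etot.
  assert (0 < f x0 / 2 * (b - a)) by (apply Rmult_lt_0_compat; lra).
  lra.
Qed.

Lemma translation_invariant_Z (f : R -> R -> R) a b :
  (forall x y, f (x + a) (y + b) = f x y) ->
  forall z x y, f (x + IZR z * a) (y + IZR z * b) = f x y.
Proof.
  intros H.
  assert (Hnat : forall n x y, f (x + INR n * a) (y + INR n * b) = f x y).
  { induction n as [| n IH]; intros x y.
    - simpl. rewrite !Rmult_0_l, !Rplus_0_r. reflexivity.
    - rewrite S_INR, <- (IH x y), <- (H (x + INR n * a) (y + INR n * b)).
      f_equal; ring. }
  intros z x y. destruct (Z.le_gt_cases 0 z) as [Hz | Hz].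
  - rewrite <- (Z2Nat.id z Hz), <- INR_IZR_INZ. apply Hnat.
  - replace z with (- Z.of_nat (Z.to_nat (- z)))%Z by (rewrite Z2Nat.id; lia).
    rewrite opp_IZR, <- INR_IZR_INZ.
    rewrite <- (Hnat (Z.to_nat (- z))). f_equal; ring.
Qed.

Lemma periodic_fundamental_domain e1x e1y e2x e2y f :
  lattice_basis e1x e1y e2x e2y -> periodic e1x e1y e2x e2y f ->
  forall x y, exists s t, 0 <= s <= 1 /\ 0 <= t <= 1 /\
    f x y = f (s * e1x + t * e2x) (s * e1y + t * e2y).
Proof.
  intros HG Hp x y. unfold lattice_basis in HG.
  set (S := (x * e2y - y * e2x) / (e1x * e2y - e1y * e2x)).
  set (T := (e1x * y - e1y * x) / (e1x * e2y - e1y * e2x)).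
  destruct (base_Int_part S) as [HS1 HS2]. destruct (base_Int_part T) as [HT1 HT2].
  set (s := S - IZR (Int_part S)). set (t := T - IZR (Int_part T)).
  exists s, t. split; [unfold s; lra |]. split; [unfold t; lra |].
  set (x0 := s * e1x + t * e2x). set (y0 := s * e1y + t * e2y).
  transitivity (f (x0 + IZR (Int_part S) * e1x + IZR (Int_part T) * e2x)
                  (y0 + IZR (Int_part S) * e1y + IZR (Int_part T) * e2y)).
  - f_equal; unfold x0, y0, s, t, S, T; field; exact HG.
  - rewrite (translation_invariant_Z f e2x e2y (fun u v => proj2 (Hp u v))).
    apply (translation_invariant_Z f e1x e1y (fun u v => proj1 (Hp u v))).
Qed.

Lemma derivable_pt_lim_translate f x c l :
  derivable_pt_lim f (x + c) l -> derivable_pt_lim (fun s => f (s + c)) x l.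
Proof.
  intros H eps He. destruct (H eps He) as [d Hd]. exists d. intros h Hh Hh'.
  replace (x + h + c) with (x + c + h) by ring. apply Hd; auto.
Qed.

Lemma periodic_partials e1x e1y e2x e2y f fx fy :
  periodic e1x e1y e2x e2y f ->
  (forall u v, derivable_pt_lim (fun s => f s v) u (fx u v)) ->
  (forall u v, derivable_pt_lim (fun t => f u t) v (fy u v)) ->
  periodic e1x e1y e2x e2y fx /\ periodic e1x e1y e2x e2y fy.
Proof.
  intros Hp Hx Hy.
  assert (Shift : forall a b x y,
    (forall u v, f (u + a) (v + b) = f u v) ->
    fx (x + a) (y + b) = fx x y /\ fy (x + a) (y + b) = fy x y).
  { intros a b x y Ha. split.
    - apply (same_partial_x (fun u v => f (u + a) (v + b)) f x y); [exact Ha | |].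
      + apply (derivable_pt_lim_translate (fun s => f s (y + b))), Hx.
      + apply Hx.
    - apply (same_partial_y (fun u v => f (u + a) (v + b)) f x y); [exact Ha | |].
      + apply (derivable_pt_lim_translate (fun t => f (x + a) t)), Hy.
      + apply Hy. }
  split; intros x y; split; apply Shift; intros u v; apply Hp.
Qed.

(* [is_mean e g v]: the mean of [g] over the fundamental parallelogram is [v],
   the same notion as the frozen [is_avg] but phrased with Coquelicot's
   [is_RInt], which carries the integration theory used below. *)
Definition is_mean (e1x e1y e2x e2y : R) (g : R -> R -> R) (v : R) : Prop :=
  exists inner : R -> R,
    (forall t, is_RInt (fun s => g (s * e1x + t * e2x) (s * e1y + t * e2y)) 0 1 (inner t)) /\
    is_RInt inner 0 1 v.

Section Means.
Variables e1x e1y e2x e2y : R.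

Lemma is_mean_of_is_avg g v : is_avg e1x e1y e2x e2y g v -> is_mean e1x e1y e2x e2y g v.
Proof.
  intros [inner [Hin Hout]]. exists inner.
  split; [intros t |]; apply is_RInt_of_integral01; auto.
Qed.

Lemma is_mean_unique g v w :
  is_mean e1x e1y e2x e2y g v -> is_mean e1x e1y e2x e2y g w -> v = w.
Proof.
  intros [i1 [H1 H2]] [i2 [H3 H4]].
  assert (E : forall t, i1 t = i2 t).
  { intros t. rewrite <- (is_RInt_unique (V := R_CompleteNormedModule) _ _ _ _ (H1 t)).
    apply (is_RInt_unique (V := R_CompleteNormedModule)); auto. }
  rewrite <- (is_RInt_unique (V := R_CompleteNormedModule) _ _ _ _ H2).
  apply (is_RInt_unique (V := R_CompleteNormedModule)).
  apply (is_RInt_ext (V := R_NormedModule) i2); [intros; rewrite E; auto | exact H4].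
Qed.

Lemma is_mean_linear g h v w p q :
  is_mean e1x e1y e2x e2y g v -> is_mean e1x e1y e2x e2y h w ->
  is_mean e1x e1y e2x e2y (fun x y => p * g x y + q * h x y) (p * v + q * w).
Proof.
  intros [i1 [H1 H2]] [i2 [H3 H4]].
  exists (fun t => p * i1 t + q * i2 t). split.
  - intros t. apply (is_RInt_plus (V := R_NormedModule)); apply (is_RInt_scal (V := R_NormedModule)); auto.
  - apply (is_RInt_plus (V := R_NormedModule)); apply (is_RInt_scal (V := R_NormedModule)); auto.
Qed.

Lemma is_mean_const k : is_mean e1x e1y e2x e2y (fun _ _ => k) k.
Proof. exists (fun _ => k). split; [intros t |]; apply is_RInt_const01. Qed.

Lemma is_mean_ext g h v : (forall x y, g x y = h x y) ->
  is_mean e1x e1y e2x e2y g v -> is_mean e1x e1y e2x e2y h v.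
Proof.
  intros E [inner [H1 H2]]. exists inner; split; [| exact H2]. intros t.
  apply (is_RInt_ext (V := R_NormedModule) (fun s => g (s * e1x + t * e2x) (s * e1y + t * e2y))); auto.
Qed.

Lemma is_mean_diff g h c v w :
  is_mean e1x e1y e2x e2y g v -> is_mean e1x e1y e2x e2y h w ->
  is_mean e1x e1y e2x e2y (fun x y => g x y - c - h x y) (v - c - w).
Proof.
  intros Hg Hh.
  replace (v - c - w) with (1 * (1 * v + (- c) * 1) + (- 1) * w) by ring.
  eapply is_mean_ext;
    [| exact (is_mean_linear _ _ _ _ 1 (- 1) (is_mean_linear _ _ _ _ 1 (- c) Hg (is_mean_const 1)) Hh)].
  intros x y. cbv beta. ring.
Qed.

Lemma constant_eq_mean g c m : (forall x y, g x y = c) ->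
  is_mean e1x e1y e2x e2y g m -> c = m.
Proof.
  intros E H. apply (is_mean_unique g); [| exact H].
  apply (is_mean_ext (fun _ _ => c)); [intros; rewrite E; auto | apply is_mean_const].
Qed.

Lemma nonneg_mean_zero q :
  lattice_basis e1x e1y e2x e2y -> periodic e1x e1y e2x e2y q ->
  (forall x y, cont2 q x y) -> (forall x y, 0 <= q x y) ->
  is_mean e1x e1y e2x e2y q 0 -> forall x y, q x y = 0.
Proof.
  intros HG Hp Hc Hnn [inner [H1 H2]].
  set (Q := fun s t => q (s * e1x + t * e2x) (s * e1y + t * e2y)).
  assert (HQ : forall s t, cont2 Q s t) by (intros; apply cont2_linear_comp; auto).
  assert (Ein : forall t, inner t = RInt (fun s => Q s t) 0 1).
  { intros t. symmetry. apply (is_RInt_unique (V := R_CompleteNormedModule)), H1. }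
  assert (Hin0 : forall t, 0 <= t <= 1 -> inner t = 0).
  { apply nonneg_zero_integral; [| | exact H2].
    - intros t _. apply (continuous_ext (fun t => RInt (fun s => Q s t) 0 1)).
      + intros; rewrite Ein; auto.
      + apply parametric_integral_continuous; auto.
    - intros t _. apply (is_RInt_ge_0 _ 0 1 _ ltac:(lra) (H1 t)). intros; apply Hnn. }
  assert (HQ0 : forall s t, 0 <= s <= 1 -> 0 <= t <= 1 -> Q s t = 0).
  { intros s t Hs Ht. apply (nonneg_zero_integral (fun s => Q s t)); auto.
    - intros z _. apply cont2_continuous_x; auto.
    - intros; apply Hnn.
    - pose proof (H1 t) as Hint. rewrite (Hin0 t Ht) in Hint. exact Hint. }
  intros x y. destruct (periodic_fundamental_domain e1x e1y e2x e2y q HG Hp x y)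
    as [s [t [Hs [Ht E]]]].
  rewrite E. apply (HQ0 s t Hs Ht).
Qed.

End Means.

(** * The mean of a partial derivative of a periodic function vanishes *)

Section MeanOfDerivative.
Variables e1x e1y e2x e2y : R.
Variables k kx ky : R -> R -> R.
Hypothesis k_periodic : periodic e1x e1y e2x e2y k.
Hypothesis k_dx : forall u v, derivable_pt_lim (fun s => k s v) u (kx u v).
Hypothesis k_dy : forall u v, derivable_pt_lim (fun t => k u t) v (ky u v).
Hypothesis kx_cont : forall u v, cont2 kx u v.
Hypothesis ky_cont : forall u v, cont2 ky u v.

Let dir_deriv p r x y := kx x y * p + ky x y * r.

Lemma dir_deriv_cont p r u v : cont2 (dir_deriv p r) u v.
Proof. unfold dir_deriv. apply cont2_plus; apply cont2_mult; auto; apply cont2_const. Qed.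

(* Along e1 every inner integral vanishes by the fundamental theorem of
   calculus and the e1-periodicity of k. *)
Lemma mean_dir_deriv_e1 : is_mean e1x e1y e2x e2y (dir_deriv e1x e1y) 0.
Proof.
  exists (fun _ => 0). split; [intros t | apply is_RInt_const01].
  eapply is_RInt_eq_value.
  - apply (is_RInt_derive (V := R_CompleteNormedModule)
      (fun s => k (s * e1x + t * e2x) (s * e1y + t * e2y))
      (fun s => dir_deriv e1x e1y (s * e1x + t * e2x) (s * e1y + t * e2y))).
    + intros s _. apply is_derive_Reals, derivable_along_line; auto.
    + intros s _.
      apply (cont2_continuous_x (fun s t => dir_deriv e1x e1y (s * e1x + t * e2x) (s * e1y + t * e2y))).
      apply cont2_linear_comp, dir_deriv_cont.
  - unfold minus, plus, opp; simpl.
    replace (1 * e1x + t * e2x) with ((0 * e1x + t * e2x) + e1x) by ring.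
    replace (1 * e1y + t * e2y) with ((0 * e1y + t * e2y) + e1y) by ring.
    rewrite (proj1 (k_periodic _ _)). ring.
Qed.

Let K s t := k (s * e1x + t * e2x) (s * e1y + t * e2y).
Let Kt s t := dir_deriv e2x e2y (s * e1x + t * e2x) (s * e1y + t * e2y).

Lemma K_dt s t : derivable_pt_lim (fun t => K s t) t (Kt s t).
Proof.
  unfold K, Kt, dir_deriv.
  apply (derivable_pt_lim_ext (fun t => k (t * e2x + s * e1x) (t * e2y + s * e1y))).
  { intros z; f_equal; ring. }
  replace (s * e1x + t * e2x) with (t * e2x + s * e1x) by ring.
  replace (s * e1y + t * e2y) with (t * e2y + s * e1y) by ring.
  apply derivable_along_line; auto.
Qed.

Lemma K_cont s t : cont2 K s t.
Proof.
  apply cont2_linear_comp, cont2_iff, differentiable_continuity_pt.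
  do 2 eexists. apply differentiable_of_partials; auto.
Qed.

Lemma Kt_cont s t : cont2 Kt s t.
Proof. apply (cont2_linear_comp (dir_deriv e2x e2y)), dir_deriv_cont. Qed.

Lemma inner_integral_derive t :
  is_derive (fun t => RInt (fun s => K s t) 0 1) t (RInt (fun s => Kt s t) 0 1).
Proof.
  rewrite <- (RInt_ext (V := R_CompleteNormedModule) (fun s => Derive (fun u => K s u) t))
    by (intros s _; apply is_derive_unique, is_derive_Reals, K_dt).
  apply (is_derive_RInt_param (fun t s => K s t) 0 1 t).
  - apply filter_forall. intros x s _. exists (Kt s x). apply is_derive_Reals, K_dt.
  - intros s _. apply (continuity_2d_pt_ext (fun u v => Kt v u)).
    { intros u v. symmetry. apply is_derive_unique, is_derive_Reals, K_dt. }
    apply cont2_iff.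
    apply (cont2_ext (fun u v => dir_deriv e2x e2y (u * e2x + v * e1x) (u * e2y + v * e1y))).
    { intros u v. unfold Kt. f_equal; ring. }
    apply cont2_linear_comp, dir_deriv_cont.
  - apply filter_forall. intros x. apply ex_RInt_slice, K_cont.
Qed.

(* Along e2 the outer integral vanishes by the fundamental theorem of
   calculus applied to the inner integral, which is e2-periodic. *)
Lemma mean_dir_deriv_e2 : is_mean e1x e1y e2x e2y (dir_deriv e2x e2y) 0.
Proof.
  exists (fun t => RInt (fun s => Kt s t) 0 1). split.
  - intros t. apply (RInt_correct (V := R_CompleteNormedModule) (fun s => Kt s t)).
    apply ex_RInt_slice, Kt_cont.
  - eapply is_RInt_eq_value.
    + apply (is_RInt_derive (V := R_CompleteNormedModule)
        (fun t => RInt (fun s => K s t) 0 1) (fun t => RInt (fun s => Kt s t) 0 1)).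
      * intros t _. apply inner_integral_derive.
      * intros t _. apply parametric_integral_continuous, Kt_cont.
    + rewrite (RInt_ext (V := R_CompleteNormedModule) (fun s => K s 1) (fun s => K s 0)).
      * unfold minus, plus, opp; simpl. ring.
      * intros s _. unfold K.
        replace (s * e1x + 1 * e2x) with ((s * e1x + 0 * e2x) + e2x) by ring.
        replace (s * e1y + 1 * e2y) with ((s * e1y + 0 * e2y) + e2y) by ring.
        apply (proj2 (k_periodic _ _)).
Qed.

(* Since e1, e2 span R^2, both coordinate partials have zero mean. *)
Lemma mean_partials_zero : lattice_basis e1x e1y e2x e2y ->
  is_mean e1x e1y e2x e2y kx 0 /\ is_mean e1x e1y e2x e2y ky 0.
Proof.
  intros HG. unfold lattice_basis in HG.
  set (det := e1x * e2y - e1y * e2x) in *.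
  assert (Comb : forall p q, is_mean e1x e1y e2x e2y
            (fun x y => p * dir_deriv e1x e1y x y + q * dir_deriv e2x e2y x y) 0).
  { intros p q. replace 0 with (p * 0 + q * 0) by ring.
    apply is_mean_linear; [apply mean_dir_deriv_e1 | apply mean_dir_deriv_e2]. }
  split.
  - eapply is_mean_ext; [| exact (Comb (e2y / det) (- e1y / det))].
    intros x y. unfold dir_deriv, det. field. exact HG.
  - eapply is_mean_ext; [| exact (Comb (- e2x / det) (e1x / det))].
    intros x y. unfold dir_deriv, det. field. exact HG.
Qed.

End MeanOfDerivative.

(* The sum, difference and product rules, restated for beta-expanded
   functions so that [apply] can decompose an expression syntactically. *)
Lemma derive_plus f g x l1 l2 : derivable_pt_lim f x l1 -> derivable_pt_lim g x l2 ->
  derivable_pt_lim (fun s => f s + g s) x (l1 + l2).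
Proof. apply derivable_pt_lim_plus. Qed.

Lemma derive_minus f g x l1 l2 : derivable_pt_lim f x l1 -> derivable_pt_lim g x l2 ->
  derivable_pt_lim (fun s => f s - g s) x (l1 - l2).
Proof. apply derivable_pt_lim_minus. Qed.

Lemma derive_opp f x l : derivable_pt_lim f x l -> derivable_pt_lim (fun s => - f s) x (- l).
Proof. apply derivable_pt_lim_opp. Qed.

Lemma derive_mult f g x l1 l2 : derivable_pt_lim f x l1 -> derivable_pt_lim g x l2 ->
  derivable_pt_lim (fun s => f s * g s) x (l1 * g x + f x * l2).
Proof. apply derivable_pt_lim_mult. Qed.

Lemma derive_const c x : derivable_pt_lim (fun _ => c) x 0.
Proof. apply derivable_pt_lim_const. Qed.

Lemma derive_eq f x l l' : derivable_pt_lim f x l -> l = l' -> derivable_pt_lim f x l'.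
Proof. intros H E; subst; exact H. Qed.

Ltac derive_with leaf :=
  repeat first [ apply derive_const | apply derive_plus | apply derive_minus
               | apply derive_opp | apply derive_mult | leaf ].

Record C2 (f fx fy fxx fxy fyy : R -> R -> R) : Prop := {
  C2_dx : forall u v, derivable_pt_lim (fun s => f s v) u (fx u v);
  C2_dy : forall u v, derivable_pt_lim (fun t => f u t) v (fy u v);
  C2_dxx : forall u v, derivable_pt_lim (fun s => fx s v) u (fxx u v);
  C2_dxy : forall u v, derivable_pt_lim (fun t => fx u t) v (fxy u v);
  C2_dyx : forall u v, derivable_pt_lim (fun s => fy s v) u (fxy u v);
  C2_dyy : forall u v, derivable_pt_lim (fun t => fy u t) v (fyy u v);
  C2_cont : forall u v, cont2 f u v;
  C2_cont_x : forall u v, cont2 fx u v;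
  C2_cont_y : forall u v, cont2 fy u v;
  C2_cont_xx : forall u v, cont2 fxx u v;
  C2_cont_xy : forall u v, cont2 fxy u v;
  C2_cont_yy : forall u v, cont2 fyy u v }.

Ltac C2_derive H :=
  first [ apply (C2_dx _ _ _ _ _ _ H) | apply (C2_dy _ _ _ _ _ _ H)
        | apply (C2_dxx _ _ _ _ _ _ H) | apply (C2_dxy _ _ _ _ _ _ H)
        | apply (C2_dyx _ _ _ _ _ _ H) | apply (C2_dyy _ _ _ _ _ _ H) ].

Ltac C2_continuity :=
  repeat first [ apply cont2_minus | apply cont2_plus | apply cont2_mult | apply cont2_const
               | eapply C2_cont; eassumption | eapply C2_cont_x; eassumption
               | eapply C2_cont_y; eassumption | eapply C2_cont_xx; eassumption
               | eapply C2_cont_xy; eassumption | eapply C2_cont_yy; eassumption ].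

Lemma C2_family_at f D i j : deriv_family f D ->
  C2 (D i j) (D (S i) j) (D i (S j)) (D (S (S i)) j) (D (S i) (S j)) (D i (S (S j))).
Proof. intros [_ [Hx [Hy Hc]]]. split; auto. Qed.

Lemma C2_ext f f' fx fy fxx fxy fyy : (forall u v, f u v = f' u v) ->
  C2 f fx fy fxx fxy fyy -> C2 f' fx fy fxx fxy fyy.
Proof.
  intros E [Hx Hy Hxx Hxy Hyx Hyy Hc Hcx Hcy Hcxx Hcxy Hcyy]. split; auto.
  - intros. apply (derivable_pt_lim_ext (fun s => f s v)); auto.
  - intros. apply (derivable_pt_lim_ext (fun t => f u t)); auto.
  - intros. apply (cont2_ext f); auto.
Qed.

Lemma C2_of_family f D : deriv_family f D ->
  C2 f (D 1%nat 0%nat) (D 0%nat 1%nat) (D 2%nat 0%nat) (D 1%nat 1%nat) (D 0%nat 2%nat).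
Proof.
  intros HD. apply (C2_ext (D 0%nat 0%nat)); [apply HD | apply (C2_family_at f D 0 0 HD)].
Qed.

Lemma C2_const c :
  C2 (fun _ _ => c) (fun _ _ => 0) (fun _ _ => 0) (fun _ _ => 0) (fun _ _ => 0) (fun _ _ => 0).
Proof. split; intros; first [apply derive_const | apply cont2_const]. Qed.

Lemma C2_minus {f fx fy fxx fxy fyy g gx gy gxx gxy gyy} :
  C2 f fx fy fxx fxy fyy -> C2 g gx gy gxx gxy gyy ->
  C2 (fun u v => f u v - g u v) (fun u v => fx u v - gx u v) (fun u v => fy u v - gy u v)
     (fun u v => fxx u v - gxx u v) (fun u v => fxy u v - gxy u v)
     (fun u v => fyy u v - gyy u v).
Proof.
  intros HF HG. split; intros;
    first [ apply derive_minus; [C2_derive HF | C2_derive HG] | C2_continuity ].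
Qed.

Lemma C2_mult {f fx fy fxx fxy fyy g gx gy gxx gxy gyy} :
  C2 f fx fy fxx fxy fyy -> C2 g gx gy gxx gxy gyy ->
  C2 (fun u v => f u v * g u v) (fun u v => fx u v * g u v + f u v * gx u v)
     (fun u v => fy u v * g u v + f u v * gy u v)
     (fun u v => fxx u v * g u v + 2 * (fx u v * gx u v) + f u v * gxx u v)
     (fun u v => fxy u v * g u v + fx u v * gy u v + fy u v * gx u v + f u v * gxy u v)
     (fun u v => fyy u v * g u v + 2 * (fy u v * gy u v) + f u v * gyy u v).
Proof.
  intros HF HG. split; intros; try C2_continuity;
    (eapply derive_eq; [derive_with ltac:(first [C2_derive HF | C2_derive HG]) | cbv beta; ring]).
Qed.

(** * Periodic harmonic functions are constant *)

(* Energy argument: the means of g gx and g gy have vanishing partials, so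
   the mean of |grad g|^2 = div (g grad g) - g Delta g is zero. *)
Lemma periodic_harmonic_gradient_zero e1x e1y e2x e2y g gx gy gxx gxy gyy :
  lattice_basis e1x e1y e2x e2y -> periodic e1x e1y e2x e2y g ->
  C2 g gx gy gxx gxy gyy -> (forall u v, gxx u v + gyy u v = 0) ->
  forall u v, gx u v = 0 /\ gy u v = 0.
Proof.
  intros HG Hp HC Hharm.
  destruct (periodic_partials _ _ _ _ _ _ _ Hp (C2_dx _ _ _ _ _ _ HC) (C2_dy _ _ _ _ _ _ HC))
    as [Px Py].
  assert (Pprod : forall h, periodic e1x e1y e2x e2y h ->
            periodic e1x e1y e2x e2y (fun u v => g u v * h u v)).
  { intros h Ph x y. cbv beta. rewrite (proj1 (Hp x y)), (proj2 (Hp x y)),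
      (proj1 (Ph x y)), (proj2 (Ph x y)). auto. }
  assert (Mx : is_mean e1x e1y e2x e2y (fun u v => gx u v * gx u v + g u v * gxx u v) 0).
  { apply (mean_partials_zero e1x e1y e2x e2y (fun u v => g u v * gx u v) _
             (fun u v => gy u v * gx u v + g u v * gxy u v)); auto;
      intros; try C2_continuity;
      (eapply derive_eq; [derive_with ltac:(C2_derive HC) | cbv beta; ring]). }
  assert (My : is_mean e1x e1y e2x e2y (fun u v => gy u v * gy u v + g u v * gyy u v) 0).
  { apply (mean_partials_zero e1x e1y e2x e2y (fun u v => g u v * gy u v)
             (fun u v => gx u v * gy u v + g u v * gxy u v)); auto;
      intros; try C2_continuity;
      (eapply derive_eq; [derive_with ltac:(C2_derive HC) | cbv beta; ring]). }
  assert (Menergy : is_mean e1x e1y e2x e2y (fun u v => gx u v * gx u v + gy u v * gy u v) 0).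
  { replace 0 with (1 * 0 + 1 * 0) by ring.
    eapply is_mean_ext; [| exact (is_mean_linear _ _ _ _ _ _ _ _ 1 1 Mx My)].
    intros x y. cbv beta. replace (gyy x y) with (- gxx x y) by (generalize (Hharm x y); lra).
    ring. }
  assert (Z : forall u v, gx u v * gx u v + gy u v * gy u v = 0).
  { apply (nonneg_mean_zero e1x e1y e2x e2y (fun u v => gx u v * gx u v + gy u v * gy u v));
      auto; intros x y; try C2_continuity.
    - cbv beta. rewrite (proj1 (Px x y)), (proj2 (Px x y)), (proj1 (Py x y)), (proj2 (Py x y)).
      auto.
    - nra. }
  intros u v. specialize (Z u v). split; nra.
Qed.

(* A periodic pair (g, w) satisfying the Cauchy-Riemann equations
   gx = wy, gy = -wx with zero means vanishes: g is harmonic, hence constant,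
   so w has zero gradient as well. *)
Lemma periodic_conjugate_pair_zero e1x e1y e2x e2y
    g gx gy gxx gxy gyy w wx wy wxx wxy wyy :
  lattice_basis e1x e1y e2x e2y -> periodic e1x e1y e2x e2y g ->
  C2 g gx gy gxx gxy gyy -> C2 w wx wy wxx wxy wyy ->
  (forall u v, gx u v = wy u v) -> (forall u v, gy u v = - wx u v) ->
  is_mean e1x e1y e2x e2y g 0 -> is_mean e1x e1y e2x e2y w 0 ->
  forall u v, g u v = 0 /\ w u v = 0.
Proof.
  intros HG Hp Cg Cw CR1 CR2 Mg Mw.
  assert (Hharm : forall u v, gxx u v + gyy u v = 0).
  { intros u v.
    assert (gxx u v = wxy u v)
      by (apply (same_partial_x gx wy u v _ _ CR1); [C2_derive Cg | C2_derive Cw]).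
    assert (gyy u v = - wxy u v).
    { apply (same_partial_y gy (fun a b => - wx a b) u v _ _ CR2);
        [C2_derive Cg | apply derive_opp; C2_derive Cw]. }
    lra. }
  assert (Zg := periodic_harmonic_gradient_zero _ _ _ _ _ _ _ _ _ _ HG Hp Cg Hharm).
  assert (Zw : forall u v, wx u v = 0 /\ wy u v = 0).
  { intros u v. rewrite <- CR1. specialize (CR2 u v). destruct (Zg u v). lra. }
  assert (Kg := constant_of_zero_gradient g gx gy
                  (C2_dx _ _ _ _ _ _ Cg) (C2_dy _ _ _ _ _ _ Cg) Zg).
  assert (Kw := constant_of_zero_gradient w wx wy
                  (C2_dx _ _ _ _ _ _ Cw) (C2_dy _ _ _ _ _ _ Cw) Zw).
  intros u v. rewrite Kg, Kw.
  split; eapply constant_eq_mean; eauto.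
Qed.

Lemma higher_derivatives_zero f D : deriv_family f D ->
  (forall u v, D 1%nat 0%nat u v = 0 /\ D 0%nat 1%nat u v = 0) ->
  forall i j u v, (1 <= i + j)%nat -> D i j u v = 0.
Proof.
  intros [_ [Hx [Hy _]]] Z.
  assert (Ind : forall n i j u v, (i + j = S n)%nat -> D i j u v = 0).
  { induction n as [| n IH]; intros i j u v Hij.
    - destruct i as [| [| i]]; destruct j as [| [| j]]; simpl in Hij; try lia; apply Z.
    - destruct i as [| i].
      + destruct j as [| j]; [simpl in Hij; lia |].
        apply (same_partial_y (D 0%nat j) (fun _ _ => 0) u v); [| apply Hy | apply derive_const].
        intros a b. apply IH. lia.
      + apply (same_partial_x (D i j) (fun _ _ => 0) u v); [| apply Hx | apply derive_const].
        intros a b. apply IH. lia. }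
  intros i j u v Hij. apply (Ind (i + j - 1)%nat). lia.
Qed.

(** * The Poisson bracket condition as a first-order system *)

Lemma family_dx f D x y : deriv_family f D ->
  derivable_pt_lim (fun s => f s y) x (D 1%nat 0%nat x y).
Proof.
  intros [H0 [Hx _]]. apply (derivable_pt_lim_ext (fun s => D 0%nat 0%nat s y)); auto.
Qed.

Lemma family_dy f D x y : deriv_family f D ->
  derivable_pt_lim (fun t => f x t) y (D 0%nat 1%nat x y).
Proof.
  intros [H0 [_ [Hy _]]]. apply (derivable_pt_lim_ext (fun t => D 0%nat 0%nat x t)); auto.
Qed.

Lemma derive_const_div c f x l : derivable_pt_lim f x l -> f x <> 0 ->
  derivable_pt_lim (fun s => c / f s) x (- (c * l) / (f x) ^ 2).
Proof.
  intros H Hn. eapply derive_eq.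
  - exact (derivable_pt_lim_div (fun _ => c) f x 0 l (derive_const c x) H Hn).
  - cbv beta. unfold Rsqr. field. exact Hn.
Qed.

(* Kolokoltsov's first-order system at the point (x,y), for the metric
   factor Lam and the coefficients a0, a1, a2 (with a3 = a1, a4 = c2 + a2 - a0);
   the last two equations say that (Lam (2 a0 - a2), Lam a1) is a
   Cauchy-Riemann pair up to the term 2 c2 Lam_y. *)
Definition kolokoltsov_eqs (Lam a0 a1 a2 : R -> R -> R) (DL DA0 DA1 DA2 : nat -> nat -> R -> R -> R)
    (c2 x y : R) : Prop :=
  4 * DL 1%nat 0%nat x y * a0 x y + 2 * Lam x y * DA0 1%nat 0%nat x y
    + DL 0%nat 1%nat x y * a1 x y = 0 /\
  4 * DL 0%nat 1%nat x y * (a2 x y - a0 x y)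
    + 2 * Lam x y * (DA2 0%nat 1%nat x y - DA0 0%nat 1%nat x y)
    + 4 * c2 * DL 0%nat 1%nat x y + a1 x y * DL 1%nat 0%nat x y = 0 /\
  DL 1%nat 0%nat x y * (2 * a0 x y - a2 x y)
    + Lam x y * (2 * DA0 1%nat 0%nat x y - DA2 1%nat 0%nat x y)
    = DL 0%nat 1%nat x y * a1 x y + Lam x y * DA1 0%nat 1%nat x y /\
  DL 1%nat 0%nat x y * a1 x y + Lam x y * DA1 1%nat 0%nat x y
    + DL 0%nat 1%nat x y * (2 * a0 x y - a2 x y)
    + Lam x y * (2 * DA0 0%nat 1%nat x y - DA2 0%nat 1%nat x y)
    = 2 * c2 * DL 0%nat 1%nat x y.

Section PoissonBracket.
Variables (Lam a0 a1 a2 a3 a4 : R -> R -> R) (DL DA0 DA1 DA2 : nat -> nat -> R -> R -> R).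
Variable c2 : R.
Hypotheses (hL : deriv_family Lam DL) (hA0 : deriv_family a0 DA0)
           (hA1 : deriv_family a1 DA1) (hA2 : deriv_family a2 DA2).
Hypothesis Lam_pos : forall x y, 0 < Lam x y.
Hypothesis commute : poisson_commute
     (fun x y p1 p2 => (p1 ^ 2 + p2 ^ 2) / (2 * Lam x y))
     (fun x y p1 p2 => a0 x y * p1 ^ 4 + a1 x y * p1 ^ 3 * p2 + a2 x y * p1 ^ 2 * p2 ^ 2
                       + a3 x y * p1 * p2 ^ 3 + a4 x y * p2 ^ 4).
Hypothesis a3_eq : forall x y, a3 x y = a1 x y.
Hypothesis a4_eq : forall x y, a4 x y = c2 + a2 x y - a0 x y.

Ltac family_leaf_x :=
  first [ apply (family_dx Lam DL); auto | apply (family_dx a0 DA0); auto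
        | apply (family_dx a1 DA1); auto | apply (family_dx a2 DA2); auto ].
Ltac family_leaf_y :=
  first [ apply (family_dy Lam DL); auto | apply (family_dy a0 DA0); auto
        | apply (family_dy a1 DA1); auto | apply (family_dy a2 DA2); auto ].

(* {H, F} = 0 at the point (x, y, P, Q), multiplied by 2 Lam^2 and written
   with the Kolokoltsov relations a3 = a1, a4 = c2 + a2 - a0: a quartic
   polynomial identity in the momenta. *)
Lemma bracket_quartic x y P Q :
  let L := Lam x y in let Lx := DL 1%nat 0%nat x y in let Ly := DL 0%nat 1%nat x y in
  let b0 := a0 x y in let b1 := a1 x y in let b2 := a2 x y in
  let b4 := c2 + a2 x y - a0 x y in
  let A0x := DA0 1%nat 0%nat x y in let A1x := DA1 1%nat 0%nat x y in
  let A2x := DA2 1%nat 0%nat x y in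
  let A0y := DA0 0%nat 1%nat x y in let A1y := DA1 0%nat 1%nat x y in
  let A2y := DA2 0%nat 1%nat x y in
  let S := P ^ 2 + Q ^ 2 in
  let Fp1 := 4 * b0 * P ^ 3 + 3 * b1 * P ^ 2 * Q + 2 * b2 * P * Q ^ 2 + b1 * Q ^ 3 in
  let Fp2 := b1 * P ^ 3 + 2 * b2 * P ^ 2 * Q + 3 * b1 * P * Q ^ 2 + 4 * b4 * Q ^ 3 in
  let Fx := A0x * P ^ 4 + A1x * P ^ 3 * Q + A2x * P ^ 2 * Q ^ 2 + A1x * P * Q ^ 3
            + (A2x - A0x) * Q ^ 4 in
  let Fy := A0y * P ^ 4 + A1y * P ^ 3 * Q + A2y * P ^ 2 * Q ^ 2 + A1y * P * Q ^ 3
            + (A2y - A0y) * Q ^ 4 in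
  - S * Lx * Fp1 - 2 * L * P * Fx - S * Ly * Fp2 - 2 * L * Q * Fy = 0.
Proof.
  intros.
  assert (HL : L <> 0) by (generalize (Lam_pos x y); unfold L; lra).
  set (F' := fun s t => a0 s t * P ^ 4 + a1 s t * P ^ 3 * Q + a2 s t * P ^ 2 * Q ^ 2
                        + a1 s t * P * Q ^ 3 + (c2 + a2 s t - a0 s t) * Q ^ 4).
  assert (EF : forall s t, a0 s t * P ^ 4 + a1 s t * P ^ 3 * Q + a2 s t * P ^ 2 * Q ^ 2
                 + a3 s t * P * Q ^ 3 + a4 s t * Q ^ 4 = F' s t)
    by (intros; unfold F'; rewrite a3_eq, a4_eq; auto).
  assert (B : - (S * (2 * Lx)) / (2 * L) ^ 2 * Fp1 - 2 * P / (2 * L) * Fx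
              + (- (S * (2 * Ly)) / (2 * L) ^ 2 * Fp2 - 2 * Q / (2 * L) * Fy) = 0).
  { apply (commute x y P Q).
    - apply (derive_const_div _ (fun s => 2 * Lam s y)); [| unfold L in HL; lra].
      eapply derive_eq; [derive_with family_leaf_x | cbv beta; unfold Lx; ring].
    - apply (derive_const_div _ (fun s => 2 * Lam x s)); [| unfold L in HL; lra].
      eapply derive_eq; [derive_with family_leaf_y | cbv beta; unfold Ly; ring].
    - apply is_derive_Reals. auto_derive; [unfold L in HL; lra |]. unfold L. field. exact HL.
    - apply is_derive_Reals. auto_derive; [unfold L in HL; lra |]. unfold L. field. exact HL.
    - apply (derivable_pt_lim_ext (fun s => F' s y)); [intros; rewrite EF; auto |].
      eapply derive_eq; [unfold F'; derive_with family_leaf_x |].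
      cbv beta. unfold Fx, A0x, A1x, A2x. ring.
    - apply (derivable_pt_lim_ext (fun t => F' x t)); [intros; rewrite EF; auto |].
      eapply derive_eq; [unfold F'; derive_with family_leaf_y |].
      cbv beta. unfold Fy, A0y, A1y, A2y. ring.
    - apply is_derive_Reals. rewrite a3_eq, a4_eq. auto_derive; [auto |].
      unfold Fp1, b0, b1, b2. ring.
    - apply is_derive_Reals. rewrite a3_eq, a4_eq. auto_derive; [auto |].
      unfold Fp2, b1, b2, b4. ring. }
  transitivity (2 * L ^ 2 * (- (S * (2 * Lx)) / (2 * L) ^ 2 * Fp1 - 2 * P / (2 * L) * Fx
                 + (- (S * (2 * Ly)) / (2 * L) ^ 2 * Fp2 - 2 * Q / (2 * L) * Fy))).
  - field. exact HL.
  - rewrite B. ring.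
Qed.

(* Coefficients of the quartic at the momenta (1,0), (0,1), (1,1), (1,-1)
   give the four first-order equations of Kolokoltsov's system. *)
Lemma kolokoltsov_system x y : kolokoltsov_eqs Lam a0 a1 a2 DL DA0 DA1 DA2 c2 x y.
Proof.
  pose proof (bracket_quartic x y 1 0) as E1. pose proof (bracket_quartic x y 0 1) as E2.
  pose proof (bracket_quartic x y 1 1) as E3. pose proof (bracket_quartic x y 1 (-1)) as E4.
  cbv zeta in E1, E2, E3, E4. unfold kolokoltsov_eqs.
  ring_simplify in E1. ring_simplify in E2. ring_simplify in E3. ring_simplify in E4.
  repeat split; lra.
Qed.

End PoissonBracket.

(** * The compatibility condition for lambda *)

Section QuarticIntegral.
Variables e1x e1y e2x e2y : R.
Hypothesis lattice : lattice_basis e1x e1y e2x e2y.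
Variables (Lam a0 a1 a2 lam : R -> R -> R) (DL DA0 DA1 DA2 D : nat -> nat -> R -> R -> R).
Variables c2 a11 a22 a12 : R.
Hypotheses (hL : deriv_family Lam DL) (hA0 : deriv_family a0 DA0)
           (hA1 : deriv_family a1 DA1) (hA2 : deriv_family a2 DA2)
           (hD : deriv_family lam D).
Hypotheses (Lam_per : periodic e1x e1y e2x e2y Lam) (a0_per : periodic e1x e1y e2x e2y a0)
           (a2_per : periodic e1x e1y e2x e2y a2) (lam_per : periodic e1x e1y e2x e2y lam).
Hypothesis kol : forall x y, kolokoltsov_eqs Lam a0 a1 a2 DL DA0 DA1 DA2 c2 x y.
Hypothesis mean11 :
  is_mean e1x e1y e2x e2y (fun x y => (2 * c2 - 2 * a0 x y + a2 x y) * Lam x y) (2 * a11).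
Hypothesis mean22 :
  is_mean e1x e1y e2x e2y (fun x y => (2 * a0 x y - a2 x y) * Lam x y) (2 * a22).
Hypothesis mean12 : is_mean e1x e1y e2x e2y (fun x y => a1 x y * Lam x y) (2 * a12).
Hypothesis laplace : forall x y,
  D 2%nat 0%nat x y + D 0%nat 2%nat x y = 2 * c2 * Lam x y - 2 * a11 - 2 * a22.

Ltac leaf_x := idtac; match goal with H : deriv_family _ _ |- _ =>
  first [ apply (proj1 (proj2 H)) | apply (family_dx _ _ _ _ H) ] end.
Ltac leaf_y := idtac; match goal with H : deriv_family _ _ |- _ =>
  first [ apply (proj1 (proj2 (proj2 H))) | apply (family_dy _ _ _ _ H) ] end.
Ltac by_dx := eapply derive_eq; [derive_with leaf_x | cbv beta; ring].
Ltac by_dy := eapply derive_eq; [derive_with leaf_y | cbv beta; ring].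

Lemma laplace_dx u v : D 3%nat 0%nat u v + D 1%nat 2%nat u v = 2 * c2 * DL 1%nat 0%nat u v.
Proof. apply (same_partial_x _ _ u v _ _ laplace); by_dx. Qed.

Lemma laplace_dy u v : D 2%nat 1%nat u v + D 0%nat 3%nat u v = 2 * c2 * DL 0%nat 1%nat u v.
Proof. apply (same_partial_y _ _ u v _ _ laplace); by_dy. Qed.

Lemma laplace_dxx u v : D 4%nat 0%nat u v + D 2%nat 2%nat u v = 2 * c2 * DL 2%nat 0%nat u v.
Proof. apply (same_partial_x _ _ u v _ _ laplace_dx); by_dx. Qed.

Lemma laplace_dxy u v : D 3%nat 1%nat u v + D 1%nat 3%nat u v = 2 * c2 * DL 1%nat 1%nat u v.
Proof. apply (same_partial_y _ _ u v _ _ laplace_dx); by_dy. Qed.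

Lemma laplace_dyy u v : D 2%nat 2%nat u v + D 0%nat 4%nat u v = 2 * c2 * DL 0%nat 2%nat u v.
Proof. apply (same_partial_y _ _ u v _ _ laplace_dy); by_dy. Qed.

(* lam_y is periodic, so lam_xy and lam_yy have zero mean; lam_yy is periodic. *)
Lemma lam_second_partials_mean_zero :
  is_mean e1x e1y e2x e2y (D 1%nat 1%nat) 0 /\ is_mean e1x e1y e2x e2y (D 0%nat 2%nat) 0 /\
  periodic e1x e1y e2x e2y (D 0%nat 2%nat).
Proof.
  destruct hD as [_ [Hx [Hy Hc]]].
  destruct (periodic_partials _ _ _ _ lam (D 1%nat 0%nat) (D 0%nat 1%nat) lam_per
              (fun u v => family_dx _ _ u v hD) (fun u v => family_dy _ _ u v hD))
    as [_ Per01].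
  destruct (periodic_partials _ _ _ _ _ (D 1%nat 1%nat) (D 0%nat 2%nat) Per01
              (Hx 0%nat 1%nat) (Hy 0%nat 1%nat)) as [_ Per02].
  destruct (mean_partials_zero e1x e1y e2x e2y (D 0%nat 1%nat) (D 1%nat 1%nat) (D 0%nat 2%nat)
              Per01 (Hx 0%nat 1%nat) (Hy 0%nat 1%nat) (Hc 1%nat 1%nat) (Hc 0%nat 2%nat) lattice)
    as [M11 M02].
  auto.
Qed.

(* The functions
   g = Lam (2 a0 - a2) - 2 a22 - lam_yy and w = Lam a1 - 2 a12 - lam_xy form a
   periodic Cauchy-Riemann pair (Kolokoltsov's last two equations and the
   y-derivative of the Laplace equation) with zero means, hence vanish. *)
Lemma lam_second_derivatives :
  (forall u v, D 0%nat 2%nat u v = Lam u v * (2 * a0 u v - a2 u v) - 2 * a22) /\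
  (forall u v, D 1%nat 1%nat u v = Lam u v * a1 u v - 2 * a12).
Proof.
  destruct lam_second_partials_mean_zero as (M11 & M02 & Per02).
  pose proof (C2_minus (C2_minus (C2_mult (C2_of_family _ _ hL)
                (C2_minus (C2_mult (C2_const 2) (C2_of_family _ _ hA0)) (C2_of_family _ _ hA2)))
                (C2_const (2 * a22))) (C2_family_at _ _ 0 2 hD)) as Cg.
  pose proof (C2_minus (C2_minus (C2_mult (C2_of_family _ _ hL) (C2_of_family _ _ hA1))
                (C2_const (2 * a12))) (C2_family_at _ _ 1 1 hD)) as Cw.
  assert (Z : forall u v,
            Lam u v * (2 * a0 u v - a2 u v) - 2 * a22 - D 0%nat 2%nat u v = 0 /\
            Lam u v * a1 u v - 2 * a12 - D 1%nat 1%nat u v = 0).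
  { eapply (periodic_conjugate_pair_zero e1x e1y e2x e2y);
      [exact lattice | | eapply C2_ext; [| exact Cg] | eapply C2_ext; [| exact Cw] | | | |].
    - intros x y. cbv beta.
      rewrite (proj1 (Lam_per x y)), (proj2 (Lam_per x y)), (proj1 (a0_per x y)),
        (proj2 (a0_per x y)), (proj1 (a2_per x y)), (proj2 (a2_per x y)),
        (proj1 (Per02 x y)), (proj2 (Per02 x y)). auto.
    - intros u v. cbv beta. ring.
    - intros u v. cbv beta. ring.
    - intros u v. cbv beta. destruct (kol u v) as (_ & _ & K3 & _). lra.
    - intros u v. cbv beta. destruct (kol u v) as (_ & _ & _ & K4).
      generalize (laplace_dy u v). lra.
    - replace 0 with (2 * a22 - 2 * a22 - 0) by ring.
      eapply is_mean_ext; [| exact (is_mean_diff _ _ _ _ _ _ (2 * a22) _ _ mean22 M02)].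
      intros x y. cbv beta. ring.
    - replace 0 with (2 * a12 - 2 * a12 - 0) by ring.
      eapply is_mean_ext; [| exact (is_mean_diff _ _ _ _ _ _ (2 * a12) _ _ mean12 M11)].
      intros x y. cbv beta. ring. }
  split; intros u v; destruct (Z u v); lra.
Qed.

(* If c2 = 0 then a11 + a22 = 0, so lam is a periodic harmonic function and
   all its derivatives vanish. *)
Lemma lam_flat_if_c2_zero : c2 = 0 ->
  forall i j u v, (1 <= i + j)%nat -> D i j u v = 0.
Proof.
  intros Hc2.
  assert (Hsum : 0 = 2 * a11 + 2 * a22).
  { apply (constant_eq_mean e1x e1y e2x e2y
             (fun x y => 1 * ((2 * c2 - 2 * a0 x y + a2 x y) * Lam x y)
                         + 1 * ((2 * a0 x y - a2 x y) * Lam x y))).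
    - intros x y. rewrite Hc2. ring.
    - replace (2 * a11 + 2 * a22) with (1 * (2 * a11) + 1 * (2 * a22)) by ring.
      apply is_mean_linear; assumption. }
  apply (higher_derivatives_zero lam D hD).
  apply (periodic_harmonic_gradient_zero e1x e1y e2x e2y (D 0%nat 0%nat) _ _ (D 2%nat 0%nat)
           (D 1%nat 1%nat) (D 0%nat 2%nat) lattice).
  - intros x y. destruct hD as [H0 _]. rewrite !H0. apply lam_per.
  - apply (C2_family_at lam D 0 0 hD).
  - intros u v. rewrite laplace, Hc2. lra.
Qed.

(* Lam^2 a0 has gradient (-(lam_xy + 2 a12) Lam_y, ...)/2: Kolokoltsov's
   first two equations, multiplied by Lam, rewritten with the formulas for
   lam_xy, lam_yy and lam_yyy. *)
Lemma first_kolokoltsov_flux u v :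
  2 * (2 * Lam u v * DL 1%nat 0%nat u v * a0 u v + Lam u v * Lam u v * DA0 1%nat 0%nat u v)
  + (D 1%nat 1%nat u v + 2 * a12) * DL 0%nat 1%nat u v = 0.
Proof.
  destruct lam_second_derivatives as [_ Q11]. destruct (kol u v) as (K1 & _).
  rewrite Q11.
  transitivity (Lam u v * (4 * DL 1%nat 0%nat u v * a0 u v + 2 * Lam u v * DA0 1%nat 0%nat u v
                           + DL 0%nat 1%nat u v * a1 u v)); [ring | rewrite K1; ring].
Qed.

Lemma lam_yyy u v : D 0%nat 3%nat u v =
  DL 0%nat 1%nat u v * (2 * a0 u v - a2 u v)
  + Lam u v * (2 * DA0 0%nat 1%nat u v - DA2 0%nat 1%nat u v).
Proof. apply (same_partial_y _ _ u v _ _ (proj1 lam_second_derivatives)); by_dy. Qed.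

Lemma second_kolokoltsov_flux u v :
  2 * (2 * Lam u v * DL 0%nat 1%nat u v * a0 u v + Lam u v * Lam u v * DA0 0%nat 1%nat u v)
  - 2 * (DL 0%nat 1%nat u v * (D 0%nat 2%nat u v + 2 * a22) + Lam u v * D 0%nat 3%nat u v)
  + 4 * c2 * Lam u v * DL 0%nat 1%nat u v
  + (D 1%nat 1%nat u v + 2 * a12) * DL 1%nat 0%nat u v = 0.
Proof.
  destruct lam_second_derivatives as [Q02 Q11]. destruct (kol u v) as (_ & K2 & _).
  rewrite Q11, Q02, lam_yyy.
  transitivity (Lam u v * (4 * DL 0%nat 1%nat u v * (a2 u v - a0 u v)
      + 2 * Lam u v * (DA2 0%nat 1%nat u v - DA0 0%nat 1%nat u v)
      + 4 * c2 * DL 0%nat 1%nat u v + a1 u v * DL 1%nat 0%nat u v)); [ring | rewrite K2; ring].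
Qed.

(* If c2 <> 0, Lam = (Delta lam + 2 a11 + 2 a22) / (2 c2); the integrability
   condition (Lam^2 a0)_xy = (Lam^2 a0)_yx of the two flux equations, written
   in terms of lam, is the claimed fourth-order identity. *)
Lemma compatibility_c2_nonzero : c2 <> 0 -> forall x y,
  D 1%nat 1%nat x y * (D 0%nat 4%nat x y - D 4%nat 0%nat x y)
  + 3 * (D 0%nat 3%nat x y * D 1%nat 2%nat x y - D 2%nat 1%nat x y * D 3%nat 0%nat x y)
  + 2 * (D 0%nat 2%nat x y * D 1%nat 3%nat x y - D 2%nat 0%nat x y * D 3%nat 1%nat x y)
  + 4 * a22 * D 1%nat 3%nat x y - 4 * a11 * D 3%nat 1%nat x y
  + 2 * a12 * (D 0%nat 4%nat x y - D 4%nat 0%nat x y) = 0.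
Proof.
  intros Hc2 x y.
  eassert (Flux1_y : _ = 0).
  { apply (same_partial_y _ (fun _ _ => 0) x y _ _ first_kolokoltsov_flux);
      [eapply derive_eq; [derive_with leaf_y | reflexivity] | apply derive_const]. }
  eassert (Flux2_x : _ = 0).
  { apply (same_partial_x _ (fun _ _ => 0) x y _ _ second_kolokoltsov_flux);
      [eapply derive_eq; [derive_with leaf_x | reflexivity] | apply derive_const]. }
  cbv beta in Flux1_y, Flux2_x.
  assert (M0 : Lam x y = (D 2%nat 0%nat x y + D 0%nat 2%nat x y + 2 * a11 + 2 * a22) / (2 * c2))
    by (rewrite laplace; field; exact Hc2).
  assert (M1 : DL 1%nat 0%nat x y = (D 3%nat 0%nat x y + D 1%nat 2%nat x y) / (2 * c2))
    by (rewrite laplace_dx; field; exact Hc2).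
  assert (M2 : DL 0%nat 1%nat x y = (D 2%nat 1%nat x y + D 0%nat 3%nat x y) / (2 * c2))
    by (rewrite laplace_dy; field; exact Hc2).
  assert (M3 : DL 2%nat 0%nat x y = (D 4%nat 0%nat x y + D 2%nat 2%nat x y) / (2 * c2))
    by (rewrite laplace_dxx; field; exact Hc2).
  assert (M4 : DL 1%nat 1%nat x y = (D 3%nat 1%nat x y + D 1%nat 3%nat x y) / (2 * c2))
    by (rewrite laplace_dxy; field; exact Hc2).
  assert (M5 : DL 0%nat 2%nat x y = (D 2%nat 2%nat x y + D 0%nat 4%nat x y) / (2 * c2))
    by (rewrite laplace_dyy; field; exact Hc2).
  match type of Flux1_y with ?A = 0 => match type of Flux2_x with ?B = 0 =>
  match goal with |- ?C = 0 =>
    replace C with (- 2 * c2 * (B - A))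
      by (rewrite M0, M1, M2, M3, M4, M5; field; exact Hc2) end end end.
  rewrite Flux1_y, Flux2_x. ring.
Qed.

Lemma quartic_integral_identity : forall x y,
  D 1%nat 1%nat x y * (D 0%nat 4%nat x y - D 4%nat 0%nat x y)
  + 3 * (D 0%nat 3%nat x y * D 1%nat 2%nat x y - D 2%nat 1%nat x y * D 3%nat 0%nat x y)
  + 2 * (D 0%nat 2%nat x y * D 1%nat 3%nat x y - D 2%nat 0%nat x y * D 3%nat 1%nat x y)
  + 4 * a22 * D 1%nat 3%nat x y - 4 * a11 * D 3%nat 1%nat x y
  + 2 * a12 * (D 0%nat 4%nat x y - D 4%nat 0%nat x y) = 0.
Proof.
  intros x y. destruct (Req_dec c2 0) as [Hc2 | Hc2].
  - rewrite !(lam_flat_if_c2_zero Hc2 _ _ x y) by (simpl; lia). ring.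
  - exact (compatibility_c2_nonzero Hc2 x y).
Qed.

End QuarticIntegral.

Theorem theorem4
  (e1x e1y e2x e2y : R) (hG : lattice_basis e1x e1y e2x e2y)
  (Lam : R -> R -> R) (hLs : smooth2 Lam) (hLp : periodic e1x e1y e2x e2y Lam)
  (hLpos : forall x y, 0 < Lam x y)
  (a0 a1 a2 a3 a4 : R -> R -> R)
  (ha0 : smooth2 a0) (ha1 : smooth2 a1) (ha2 : smooth2 a2)
  (ha3 : smooth2 a3) (ha4 : smooth2 a4)
  (hp0 : periodic e1x e1y e2x e2y a0) (hp1 : periodic e1x e1y e2x e2y a1)
  (hp2 : periodic e1x e1y e2x e2y a2) (hp3 : periodic e1x e1y e2x e2y a3)
  (hp4 : periodic e1x e1y e2x e2y a4)
  (hPB : poisson_commute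
     (fun x y p1 p2 => (p1 ^ 2 + p2 ^ 2) / (2 * Lam x y))
     (fun x y p1 p2 => a0 x y * p1 ^ 4 + a1 x y * p1 ^ 3 * p2 + a2 x y * p1 ^ 2 * p2 ^ 2
                       + a3 x y * p1 * p2 ^ 3 + a4 x y * p2 ^ 4))
  (c2 : R)
  (hK1 : forall x y, a3 x y = a1 x y)
  (hK2 : forall x y, a4 x y = c2 + a2 x y - a0 x y)
  (a11 a22 a12 : R)
  (h11 : is_avg e1x e1y e2x e2y (fun x y => (2 * c2 - 2 * a0 x y + a2 x y) * Lam x y) (2 * a11))
  (h22 : is_avg e1x e1y e2x e2y (fun x y => (2 * a0 x y - a2 x y) * Lam x y) (2 * a22))
  (h12 : is_avg e1x e1y e2x e2y (fun x y => a1 x y * Lam x y) (2 * a12))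
  (lam : R -> R -> R) (D : nat -> nat -> R -> R -> R) (hD : deriv_family lam D)
  (hlp : periodic e1x e1y e2x e2y lam)
  (hlap : forall x y, D 2%nat 0%nat x y + D 0%nat 2%nat x y
                      = 2 * c2 * Lam x y - 2 * a11 - 2 * a22) :
  forall x y,
    D 1%nat 1%nat x y * (D 0%nat 4%nat x y - D 4%nat 0%nat x y)
    + 3 * (D 0%nat 3%nat x y * D 1%nat 2%nat x y - D 2%nat 1%nat x y * D 3%nat 0%nat x y)
    + 2 * (D 0%nat 2%nat x y * D 1%nat 3%nat x y - D 2%nat 0%nat x y * D 3%nat 1%nat x y)
    + 4 * a22 * D 1%nat 3%nat x y - 4 * a11 * D 3%nat 1%nat x y
    + 2 * a12 * (D 0%nat 4%nat x y - D 4%nat 0%nat x y) = 0.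
Proof.
  destruct hLs as [DL hL], ha0 as [DA0 hA0], ha1 as [DA1 hA1], ha2 as [DA2 hA2].
  pose proof (kolokoltsov_system Lam a0 a1 a2 a3 a4 DL DA0 DA1 DA2 c2
                hL hA0 hA1 hA2 hLpos hPB hK1 hK2) as kol.
  exact (quartic_integral_identity e1x e1y e2x e2y hG Lam a0 a1 a2 lam DL DA0 DA1 DA2 D
           c2 a11 a22 a12 hL hA0 hA1 hA2 hD hLp hp0 hp2 hlp kol
           (is_mean_of_is_avg _ _ _ _ _ _ h11) (is_mean_of_is_avg _ _ _ _ _ _ h22)
           (is_mean_of_is_avg _ _ _ _ _ _ h12) hlap).
Qed.
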